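(* Let $m\ge 1$, let $P_2=[u_1,u_2]$ be the path of order $2$ and let $P_m=[v_1,\dots,v_m]$ be the path of order $m$. Then the harmonic centrality of any vertex $(u_i,v_j)$ of the direct product $P_2\times P_m$ is $$\mathcal{H}_{P_2\times P_m}(u_i,v_j)=\begin{cases}\dfrac{H_{m-1}}{2m-1} & \text{for } i=1,2 \text{ and } j=1 \text{ or } m,\\[2mm] \dfrac{H_{j-1}+H_{m-j}}{2m-1} & \text{for } i=1,2 \text{ and } 1<j<m.\end{cases}$$
   Context: All graphs are simple, undirected and finite. For a graph $G$ of order $n\ge 2$ (number of vertices) and a vertex $u$, the harmonic centrality of $u$ is $\mathcal{H}_G(u)=\frac{\mathcal{R}_G(u)}{n-1}$, where $\mathcal{R}_G(u)=\sum_{x\in V(G),\,x\ne u}\frac{1}{d(u,x)}$, $d$ is the shortest-path distance in $G$, and $\frac{1}{d(u,x)}=0$ if there is no path from $u$ to $x$. $H_n=\sum_{k=1}^n \frac1k$ is the $n$-th harmonic number (with $H_0=0$). The path $[v_1,\dots,v_m]$ has edges $v_kv_{k+1}$ for $1\le k<m$. The direct product $G\times H$ has vertex set $V(G)\times V(H)$, with $(u,v)$ and $(u',v')$ adjacent iff $u,u'$ are adjacent in $G$ and $v,v'$ are adjacent in $H$. *)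

(* Defs.v *)
From HB Require Import structures.
From mathcomp Require Import all_boot all_order all_algebra.

Set Implicit Arguments.
Unset Strict Implicit.
Unset Printing Implicit Defensive.

Import Order.TTheory GRing.Theory Num.Theory.
Local Open Scope ring_scope.

Record sgraph := SGraph {
  vertex :> finType;
  adj : rel vertex;
  adj_sym : symmetric adj;
  adj_irr : irreflexive adj }.

Section Distance.
Variable G : sgraph.
Implicit Types (u x : G) (n : nat).

(* A path from u is given by its remaining vertices, so that the length
   (number of edges) of u :: p is the size of p. *)
Definition path_of_length u x n : bool :=
  [exists p : n.-tuple G,
    [&& path (@adj G) u p, uniq (u :: p) & last u p == x]].

Lemma path_of_lengthP u x n :
  reflect (exists p : seq G,
             [/\ size p = n, path (@adj G) u p, uniq (u :: p) & last u p = x])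
          (path_of_length u x n).
Proof.
apply: (iffP existsP) => [[p /and3P[pp up /eqP lp]]|[p [/eqP sp pp up lp]]].
  by exists p; split=> //; rewrite size_tuple.
by exists (Tuple sp); apply/and3P; split=> //; apply/eqP.
Qed.

Lemma connect_path_of_length u x :
  connect (@adj G) u x -> exists n, path_of_length u x n.
Proof.
case/connectP=> p pp ->; case/shortenP: pp => p' pp' up' _.
by exists (size p'); apply/path_of_lengthP; exists p'.
Qed.

(* None when there is no path from u to x. *)
Definition dist u x : option nat :=
  if @idP (connect (@adj G) u x) is ReflectT ux
  then Some (ex_minn (connect_path_of_length ux)) else None.

Lemma dist_SomeP u x n :
  dist u x = Some n <->
  path_of_length u x n /\ forall k, path_of_length u x k -> (n <= k)%N.
Proof.
rewrite /dist; case: {-}_ / idP => [ux|nux]; last first.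
  split=> // -[/path_of_lengthP[p [_ pp _ lp]] _].
  by case: nux; apply/connectP; exists p.
case: ex_minnP => d pd mind; split=> [[<-] //|[pn minn]].
by congr Some; apply/eqP; rewrite eqn_leq mind // minn.
Qed.

Lemma dist_NoneP u x :
  dist u x = None <-> forall n, ~~ path_of_length u x n.
Proof.
rewrite /dist; case: {-}_ / idP => [ux|nux].
  by split=> // np; have [n pn] := connect_path_of_length ux; case/negP: (np n).
split=> // _ n; apply/negP=> /path_of_lengthP[p [_ pp _ lp]].
by case: nux; apply/connectP; exists p.
Qed.

Definition inv_dist u x : rat :=
  if dist u x is Some d then d%:R^-1 else 0.

Definition reciprocal_sum u : rat := \sum_(x : G | x != u) inv_dist u x.

Definition harmonic_centrality u : rat :=
  reciprocal_sum u / (#|G|%:R - 1).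

End Distance.

Definition harmonic_number (n : nat) : rat := \sum_(1 <= k < n.+1) k%:R^-1.

(* Vertices are numbered from 0: the vertex v_k, 1 <= k <= m, of the path
   [v_1, ..., v_m] is the ordinal of value k - 1. *)
Definition path_adj (m : nat) : rel 'I_m :=
  fun a b => (a.+1 == b :> nat) || (b.+1 == a :> nat).

Lemma path_adj_sym m : symmetric (@path_adj m).
Proof. by move=> a b; rewrite /path_adj orbC. Qed.

Lemma path_adj_irr m : irreflexive (@path_adj m).
Proof. by move=> a; rewrite /path_adj orbb gtn_eqF. Qed.

Definition path_graph (m : nat) : sgraph :=
  SGraph (@path_adj_sym m) (@path_adj_irr m).

Definition direct_adj (G H : sgraph) : rel (G * H)%type :=
  fun a b => adj a.1 b.1 && adj a.2 b.2.

Lemma direct_adj_sym G H : symmetric (@direct_adj G H).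
Proof. by move=> a b; rewrite /direct_adj adj_sym [adj a.2 _]adj_sym. Qed.

Lemma direct_adj_irr G H : irreflexive (@direct_adj G H).
Proof. by move=> a; rewrite /direct_adj adj_irr. Qed.

Definition direct_product (G H : sgraph) : sgraph :=
  SGraph (@direct_adj_sym G H) (@direct_adj_irr G H).

(* Main.v *)
Require Import Defs.
From mathcomp Require Import all_boot all_order all_algebra.
From mathcomp Require Import zify.

Import Order.TTheory GRing.Theory Num.Theory.
Local Open Scope ring_scope.

(** An edge of [P_2 x P_m] changes the second coordinate by one and flips the
    first, so the parity of [i + j] is invariant and the graph is the disjoint
    union of two copies of [P_m], one per parity class, each projecting
    isomorphically onto [P_m].  Hence [(i, j)] is at distance [|j - b|] from
    exactly one of the two vertices above [b] and disconnected from the other,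
    and the reciprocal sum is [sum_(b != j) 1 / |j - b| = H_(j-1) + H_(m-j)]
    (with [j] numbered from 1). *)

(** [dist] ranges over simple paths, but any walk shortens to a simple path using a subset of its
    vertices, so minimality among walks suffices. *)
Lemma dist_walk (G : sgraph) (u x : G) (p : seq G) :
  path (@adj G) u p -> last u p = x ->
  (forall q, path (@adj G) u q -> last u q = x -> size p <= size q)%N ->
  dist u x = Some (size p).
Proof.
move=> pp lp minp; apply/dist_SomeP; split; last first.
  by move=> k /path_of_lengthP[q [<- pq _ lq]]; exact: minp.
apply/path_of_lengthP; move: lp; case/shortenP: pp minp => q pq uq sqp minp lq.
exists q; split=> //; apply/eqP; rewrite eqn_leq minp // andbT.
by case/andP: uq => _ uq; apply: uniq_leq_size.
Qed.

Section P2xPm.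
Variable m : nat.
Let G := direct_product (path_graph 2) (path_graph m).
Implicit Types u x : G.

(* Truncated subtractions: this is [|a - b|]. *)
Let gap (a b : nat) : nat := (a - b + (b - a))%N.

Lemma leq_gapD a b c : (gap a c <= gap a b + gap b c)%N.
Proof. by rewrite /gap; lia. Qed.

Lemma adj_P2xPm u x :
  adj u x =
    [&& odd (u.1 + u.2) == odd (x.1 + x.2) & gap u.2 x.2 == 1]%N.
Proof.
case: u x => [[i i2] j] [[a a2] b]; rewrite /= /direct_adj /= /path_adj /= /gap.
lia.
Qed.

Lemma walk_P2xPm u (p : seq G) :
  path (@adj G) u p ->
  odd (u.1 + u.2) = odd ((last u p).1 + (last u p).2) /\
  (gap u.2 (last u p).2 <= size p)%N.
Proof.
elim: p u => [|x p IHp] u; first by rewrite /gap subnn.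
case/andP; rewrite adj_P2xPm => /andP[/eqP -> /eqP ux] /IHp[-> le_p].
split=> //; apply: leq_trans (leq_gapD u.2 x.2 _) _.
by rewrite ux add1n ltnS.
Qed.

Lemma ex_walk_P2xPm u x :
  odd (u.1 + u.2) = odd (x.1 + x.2) ->
  exists p : seq G,
    [/\ path (@adj G) u p, last u p = x & size p = gap u.2 x.2].
Proof.
move: {2}(gap _ _) (erefl (gap u.2 x.2)) => n.
elim: n u => [|n IHn] u ux oux.
  (* Gap 0 makes the second coordinates equal; equal parity then forces the first ones to agree. *)
  exists [::]; split=> //=.
  case: u x ux oux => [[i i2] [j jm]] [[a a2] [b bm]]; rewrite /gap /= => ux oux.
  by congr pair; apply: val_inj => /=; lia.
have [w /andP[uw ow] wx] : exists2 w, adj u w &&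
    (odd (w.1 + w.2) == odd (x.1 + x.2)) & gap w.2 x.2 = n.
  case: u x {IHn} ux oux => [i [j jm]] [a [b bm]]; rewrite /gap /= => ux oux.
  have km : ((if j < b then j.+1 else j.-1) < m)%N by case: ifP; lia.
  have [k kE] : exists k : 'I_m, k = (if j < b then j.+1 else j.-1)%N :> nat.
    by exists (Ordinal km).
  (* On ['I_2], [rev_ord] swaps the two vertices, while [k] is one step from [j] towards [b]. *)
  exists (rev_ord i, k); rewrite /= /direct_adj /= /path_adj /= kE.
    by case: i oux => [i i2] /= oux; case: ifP; lia.
  by case: ifP; lia.
have [p [pp lp sp]] := IHn w wx (eqP ow).
by exists (w :: p); split; [apply/andP | | rewrite /= sp wx].
Qed.

Lemma inv_dist_P2xPm u x :
  inv_dist u x =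
    if odd (u.1 + u.2) == odd (x.1 + x.2) then (gap u.2 x.2)%:R^-1 else 0.
Proof.
rewrite /inv_dist; case: eqP => [|nux].
  case/ex_walk_P2xPm=> p [pp lp sp]; rewrite (dist_walk _ _ _ p) ?sp //.
  by move=> q pq <-; have [] := walk_P2xPm u q pq.
suff -> : dist u x = None by [].
apply/dist_NoneP => n; apply/path_of_lengthP=> -[p [_ pp _ lp]].
by apply: nux; have [-> _] := walk_P2xPm u p pp; rewrite lp.
Qed.

Lemma sum_inv_gap (j : nat) : (j < m)%N ->
  \sum_(b < m) (gap j b)%:R^-1 =
    harmonic_number j + harmonic_number (m - j.+1) :> rat.
Proof.
move=> jm; rewrite -(big_mkord xpredT (fun b => (gap j b)%:R^-1)).
rewrite (big_cat_nat (n := j)) ?(ltnW jm) //=; congr (_ + _).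
  (* Below [j] the gaps decrease to 1, hence the reversal. *)
  rewrite big_nat_rev /harmonic_number big_add1 /=; apply: eq_big_nat => k kj.
  by congr (_%:R^-1); rewrite /gap; lia.
(* The term [b = j] is [0^-1 = 0]. *)
rewrite big_ltn // {1}/gap subnn invr0 add0r.
rewrite -[X in \big[_/_]_(X <= _ < m) _]add0n big_addn.
rewrite /harmonic_number big_add1 /=; apply: eq_big_nat => k km.
by congr (_%:R^-1); rewrite /gap; lia.
Qed.

Lemma reciprocal_sum_P2xPm u :
  reciprocal_sum u = harmonic_number u.2 + harmonic_number (m - u.2.+1).
Proof.
(* The term [x = u] may be added, because its value is [0^-1 = 0]. *)
transitivity (\sum_x inv_dist u x).
  by rewrite [RHS](bigD1 u) //= inv_dist_P2xPm eqxx /gap subnn invr0 add0r.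
rewrite -sum_inv_gap //; under eq_bigr do rewrite inv_dist_P2xPm.
rewrite -(pair_bigA _ (fun (a : 'I_2) (b : 'I_m) =>
  if odd (u.1 + u.2) == odd (a + b) then (gap u.2 b)%:R^-1 else 0)) /=.
rewrite exchange_big; apply: eq_bigr => b _.
(* Of the two vertices above [b], exactly one has the parity of [u]. *)
rewrite !big_ord_recl big_ord0 /= addr0 add0n.
by case: (odd b); case: (odd _); rewrite ?addr0 ?add0r.
Qed.

Lemma harmonic_centrality_P2xPm u :
  harmonic_centrality u =
    (harmonic_number u.2 + harmonic_number (m - u.2.+1)) / ((2 * m)%:R - 1).
Proof. by rewrite /harmonic_centrality reciprocal_sum_P2xPm card_prod !card_ord. Qed.

End P2xPm.

(* (i, j) is the vertex (u_{i+1}, v_{j+1}) of P_2 x P_m. *)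
Theorem theorem3p7 (m : nat) (hm : (1 <= m)%N) (i : 'I_2) (j : 'I_m) :
  let P2xPm := direct_product (path_graph 2) (path_graph m) in
  ((j.+1 = 1 \/ j.+1 = m)%N ->
     harmonic_centrality (G := P2xPm) (i, j) =
     harmonic_number (m - 1) / ((2 * m)%:R - 1)) /\
  ((1 < j.+1 < m)%N ->
     harmonic_centrality (G := P2xPm) (i, j) =
     (harmonic_number (j.+1 - 1) + harmonic_number (m - j.+1))
       / ((2 * m)%:R - 1)).
Proof.
(* At an end of the path, one of the two harmonic numbers is [harmonic_number 0]. *)
have H0 : harmonic_number 0 = 0 by rewrite /harmonic_number big_geq.
split=> [[[j0]|jm]|_]; rewrite harmonic_centrality_P2xPm /=.
- by case: j0 => ->; rewrite H0 add0r.
- by rewrite jm subnn H0 addr0 -[X in (X - 1)%N]jm subn1.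
- by rewrite [(j.+1 - 1)%N]subn1.
Qed.
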